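(* If $G$ is a connected finite simple graph that contains a simplicial vertex, then $\gamma_t(G)\neq 3$ or $\gamma_{\rm gr}^{\rm Z}(G)\neq 3$.
   Context: A vertex $v$ is simplicial if its open neighborhood $N(v)$ induces a complete graph. $N[v]=N(v)\cup\{v\}$. A total dominating set is a set $D$ such that every vertex has a neighbor in $D$; $\gamma_t(G)$ is the minimum size of one. A sequence $(v_1,\ldots,v_k)$ of distinct vertices is a Z-sequence if for every $i\in\{1,\ldots,k\}$, $N(v_i)\setminus\bigcup_{j<i}N[v_j]\ne\emptyset$; $\gamma_{\rm gr}^{\rm Z}(G)$ is the maximum length of a Z-sequence. *)

(* Defs.v *)
(* A finite simple graph is a symmetric irreflexive relation
   [e : rel T] on a finite type of vertices [T]. *)
From mathcomp Require Import all_boot.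

Set Implicit Arguments.
Unset Strict Implicit.
Unset Printing Implicit Defensive.

Section Graph.

Variables (T : finType) (e : rel T).

Definition connected_graph : Prop := 0 < #|T| /\ forall x y : T, connect e x y.

Definition nbhd (v : T) : {set T} := [set w | e v w].

Definition cnbhd (v : T) : {set T} := v |: nbhd v.

Definition simplicial (v : T) : Prop :=
  {in nbhd v &, forall x y, x != y -> e x y}.

Definition total_dominating (D : {set T}) : bool :=
  [forall v, exists u in D, e v u].

(* Total dominating sets exist iff no vertex is isolated; otherwise the value
   is the default #|T|. The only connected graph concerned is K_1, where the
   default is 1. *)
Definition total_domination_number : nat :=
  \big[minn/#|T|]_(D : {set T} | total_dominating D) #|D|.

Definition Zsequence (k : nat) (s : k.-tuple T) : bool :=
  uniq s &&
  [forall i : 'I_k,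
    nbhd (tnth s i) :\: \bigcup_(j < k | j < i) cnbhd (tnth s j) != set0].

(* Entries are distinct, so the length of a Z-sequence is at most #|T|. *)
Definition Z_grundy_number : nat :=
  \max_(k < #|T|.+1 | [exists s : k.-tuple T, Zsequence s]) k.

End Graph.

(* Main.v *)
(* A Z-sequence stops being extendable only when it dominates the graph, and
   [total_domination_number e >= 3] says that no edge dominates.  Let [s] be
   simplicial, let [a] be a neighbour of [s] with a neighbour outside [N[s]],
   and let [c] be a neighbour of [a] with a neighbour outside [N[a]].  Since
   [N[s]] is contained in [N[a]], the sequence (s, a, c) dominates no more than
   the edge [ac], so it extends to a Z-sequence of length 4. *)
Require Import Defs.
From mathcomp Require Import all_boot.

Lemma bigmin_leq_id (I : Type) (r : seq I) (P : pred I) (F : I -> nat) m :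
  \big[minn/m]_(i <- r | P i) F i <= m.
Proof. by elim/big_rec: _ => // i x _; apply: leq_trans; apply: geq_minr. Qed.

Lemma bigmin_leq_cond (I : eqType) (r : seq I) (P : pred I) (F : I -> nat) m i :
  i \in r -> P i -> \big[minn/m]_(j <- r | P j) F j <= F i.
Proof.
elim: r => // j r IHr; rewrite inE big_cons => /predU1P [<- -> | ri Pi].
  exact: geq_minl.
case: ifP => _; last exact: IHr.
by apply: leq_trans (geq_minr _ _) _; apply: IHr.
Qed.

Section Graph.

Set Implicit Arguments.
Unset Strict Implicit.

Variables (T : finType) (e : rel T).
Hypothesis e_sym : symmetric e.

Lemma in_cnbhd v w : (w \in cnbhd e v) = (w == v) || e v w.
Proof. by rewrite !inE. Qed.

Lemma leq_total_domination_number D :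
  total_dominating e D -> total_domination_number e <= #|D|.
Proof. by move=> domD; apply: bigmin_leq_cond; rewrite ?mem_index_enum. Qed.

Lemma leq_Z_grundy_number k (s : k.-tuple T) :
  Zsequence e s -> k <= Z_grundy_number e.
Proof.
move=> Zs; have /andP [uniq_s _] := Zs.
have lt_k : k < #|T|.+1.
  by rewrite ltnS -{1}(size_tuple s) -(card_uniqP uniq_s) max_card.
apply: (leq_bigmax_cond (Ordinal lt_k)) => /=.
by apply/existsP; exists s.
Qed.

(** If [N[x]] and [N[y]] covered the graph, [[set x; y]] would be a total dominating set of size at
    most 2: the endpoints of the edge are neighbors of each other. *)
Lemma undominated_by_edge x y :
  2 < total_domination_number e -> e x y ->
  exists w, w \notin cnbhd e x :|: cnbhd e y.
Proof.
move=> gt2 exy; apply/existsP; apply: contraLR gt2 => /existsPn domxy.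
rewrite -leqNgt; apply: leq_trans (_ : #|[set x; y]| <= 2); last first.
  by rewrite cards2; case: (x != y).
apply: leq_total_domination_number; apply/forallP => v.
have := domxy v; rewrite negbK in_setU !in_cnbhd => dom_v.
have [exv | exv] := boolP (e x v).
  by apply/existsP; exists x; rewrite set21 e_sym.
have [eyv | eyv] := boolP (e y v).
  by apply/existsP; exists y; rewrite set22 e_sym.
rewrite (negbTE exv) (negbTE eyv) !orbF in dom_v.
case/orP: dom_v => /eqP ->; apply/existsP.
  by exists y; rewrite set22.
by exists x; rewrite set21 e_sym.
Qed.

(** With no such edge, [A] would be closed under adjacency, so connectivity would carry membership
    from [x] to [y]. *)
Lemma connected_boundary (A : {set T}) x y :
  connected_graph e -> x \in A -> y \notin A ->
  exists u v, [/\ u \in A, v \notin A & e u v].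
Proof.
move=> [_ conn] Ax Ay.
have [/existsP [u /existsP [v /and3P [*]]] | /existsPn noedge] :=
  boolP [exists u, exists v, [&& u \in A, v \notin A & e u v]].
  by exists u, v.
have clA : closed e A.
  apply: intro_closed => [|u v euv Au]; first exact: sym_connect_sym.
  by have /existsPn/(_ v) := noedge u; rewrite Au euv andbT negbK.
by move: Ay; rewrite -(closed_connect clA (conn x y)) Ax.
Qed.

Lemma Zsequence4 a b c d wa wb wc wd :
    wa \in nbhd e a ->
    wb \in nbhd e b -> wb \notin cnbhd e a ->
    wc \in nbhd e c -> wc \notin cnbhd e a -> wc \notin cnbhd e b ->
    wd \in nbhd e d -> wd \notin cnbhd e a -> wd \notin cnbhd e b ->
    wd \notin cnbhd e c ->
  Zsequence e [tuple a; b; c; d].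
Proof.
move=> Na Nb b1 Nc c1 c2 Nd d1 d2 d3.
(* Distinctness of the entries comes for free from the witnesses: [w] separates [N(y)] from
   [N[x]]. *)
have neq x y w : w \notin cnbhd e x -> w \in nbhd e y -> x != y.
  by move=> xw yw; apply: contraNneq xw => ->; rewrite in_setU yw orbT.
apply/andP; split.
  rewrite /= !inE !negb_or (neq _ _ _ b1 Nb) (neq _ _ _ c1 Nc).
  rewrite (neq _ _ _ d1 Nd) (neq _ _ _ c2 Nc) (neq _ _ _ d2 Nd).
  by rewrite (neq _ _ _ d3 Nd).
apply/forallP => i; apply/set0Pn; exists (tnth [tuple wa; wb; wc; wd] i).
rewrite in_setD; apply/andP; split; last first.
  by case: i => [[|[|[|[|i]]]] lti].
apply/bigcupP => -[j].
case: i j => [[|[|[|[|i]]]] lti] [[|[|[|[|j]]]] ltj] //= _;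
  rewrite !(tnth_nth a) /=; exact/negP.
Qed.

Lemma simplicial_cnbhd_sub s a :
  simplicial e s -> e s a -> cnbhd e s \subset cnbhd e a.
Proof.
move=> simp_s esa; apply/subsetP => x; rewrite !in_cnbhd.
case/predU1P => [-> | esx]; first by rewrite e_sym esa orbT.
by case: eqVneq => //= neq_xa; apply: simp_s; rewrite ?inE // eq_sym.
Qed.

Lemma simplicial_Z_grundy_number s :
    connected_graph e -> simplicial e s -> 2 < total_domination_number e ->
  3 < Z_grundy_number e.
Proof.
move=> conn simp_s gt2.
have nbr x : exists y, e x y.
  (* The default value [#|T|] bounds the minimum from above, so there are at least two vertices. *)
  have /card_gt0P [y] : 0 < #|[set~ x]|.
    rewrite cardsC1 -subn1 subn_gt0.
    by apply: leq_trans (bigmin_leq_id _ _ _ _ _); apply: ltnW gt2.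
  rewrite !inE -in_set1 => neq_yx.
  have [u [v [/set1P -> _ exv]]] := connected_boundary conn (set11 x) neq_yx.
  by exists v.
(* An edge leaving [N[x]] cannot start at [x] itself, so it starts at a neighbor of [x]. *)
have exit x w : w \notin cnbhd e x ->
    exists y z, [/\ e x y, e y z & z \notin cnbhd e x].
  have xx : x \in cnbhd e x by rewrite in_cnbhd eqxx.
  case/(connected_boundary conn xx) => y [z [xy xz eyz]].
  exists y, z; split=> //; move: xy xz; rewrite !in_cnbhd.
  by case/predU1P => // eq_yx; rewrite -eq_yx eyz orbT.
(* The vertex [b] serves only to show that [N[s]] is not the whole graph. *)
have [b esb] := nbr s.
have [w] := undominated_by_edge gt2 esb.
rewrite in_setU negb_or => /andP [sw _].
have [a [wa [esa eawa swa]]] := exit _ _ sw.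
have sub_sa := simplicial_cnbhd_sub simp_s esa.
have [w'] := undominated_by_edge gt2 esa.
rewrite in_setU negb_or => /andP [_ aw'].
have [c [wc [eac ecwc awc]]] := exit _ _ aw'.
have [wd] := undominated_by_edge gt2 eac.
rewrite [_ \in _]in_setU negb_or => /andP [awd cwd].
(* Any neighbor [d] of the undominated vertex [wd] can be the fourth entry. *)
have [d ewdd] := nbr wd.
have s_of_a x : x \notin cnbhd e a -> x \notin cnbhd e s.
  by apply: contraNN => /(subsetP sub_sa).
apply: (leq_Z_grundy_number (s := [tuple s; a; c; d])).
(* The entry [a] is itself the witness for [s]; [wc] and [wd] avoid [N[s]] because they avoid the
   larger [N[a]]. *)
apply: (Zsequence4 (wa := a) (wb := wa) (wc := wc) (wd := wd)) => //;
  by rewrite ?[_ \in nbhd _ _]inE ?s_of_a // e_sym.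
Qed.

End Graph.

Theorem theorem3p6 (T : finType) (e : rel T)
    (e_sym : symmetric e) (e_irr : irreflexive e)
    (e_conn : connected_graph e)
    (e_simplicial : exists v : T, simplicial e v) :
  total_domination_number e <> 3 \/ Z_grundy_number e <> 3.
Proof.
have [eq3 | /eqP neq3] := eqVneq (total_domination_number e) 3; last by left.
right=> Z3; case: e_simplicial => s simp_s.
have := simplicial_Z_grundy_number e_sym e_conn simp_s.
by rewrite eq3 Z3 => /(_ isT).
Qed.
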